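(* Let $a,b>0$ and let $l(t,x)$ be the density of the inverse $L_t$ of the gamma subordinator with Laplace exponent $\Phi(\lambda)=a\ln(1+\lambda/b)$. Then the following representation holds: $$l(t,x)=\frac{a\,\gamma(ax,bt)}{\Gamma(ax)}\left(\psi_0(ax)-\Psi_0(ax,bt)\right),\qquad t>0,\ x>0 .$$
   Context: Fix $a,b>0$. The gamma subordinator $H=\{H_t\}_{t\ge0}$ is the subordinator started at $H_0=0$ with $\mathbf{E}_0[e^{-\lambda H_t}]=e^{-t\Phi(\lambda)}$, $\lambda\ge0$, $\Phi(\lambda)=a\ln(1+\lambda/b)$. For $t>0$ the law of $H_t$ has density $h(t,x)=\frac{b^{at}}{\Gamma(at)}x^{at-1}e^{-bx}$ for $x>0$ (and $0$ for $x\le0$). The inverse process is $L_t=\inf\{s>0:H_s\notin(0,t)\}$, $t>0$; one has $\mathbf{P}_0(H_t<s)=\mathbf{P}_0(L_s>t)$ for $s,t>0$. The density $l$ is defined by $\mathbf{P}_0(L_t\in dx)=l(t,x)\,dx$, i.e. $l(t,x)=-\frac{d}{dx}\mathbf{P}_0(L_t>x)$. Special functions: the incomplete gamma function $\gamma(p,z)=\int_0^z e^{-y}y^{p-1}\,dy$ ($p>0$, $z\ge0$); the digamma function $\psi_0(z)=\frac{1}{\Gamma(z)}\int_0^\infty y^{z-1}\ln y\;e^{-y}\,dy$ ($z>0$); the incomplete digamma function $\Psi_0(p,z)=\frac{1}{\gamma(p,z)}\int_0^z y^{p-1}e^{-y}\ln y\,dy$ ($p>0$, $z>0$). *)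

(* Defs.v *)
From HB Require Import structures.
From mathcomp Require Export all_boot all_order all_algebra.
From mathcomp Require Export all_classical all_reals all_analysis measurable_realfun.
Import Order.TTheory GRing.Theory Num.Theory.
Import numFieldNormedType.Exports.

Set Implicit Arguments.
Unset Strict Implicit.
Unset Printing Implicit Defensive.

Local Open Scope classical_set_scope.
Local Open Scope ring_scope.

Section special_functions.
Context {R : realType}.
Implicit Types p z : R.

Definition Gamma p : R :=
  \int[lebesgue_measure]_(y in `]0, +oo[) (y `^ (p - 1) * expR (- y)).

Definition inc_gamma p z : R :=
  \int[lebesgue_measure]_(y in `]0, z[) (expR (- y) * y `^ (p - 1)).

Definition digamma z : R :=
  (Gamma z)^-1 *
  \int[lebesgue_measure]_(y in `]0, +oo[) (y `^ (z - 1) * ln y * expR (- y)).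

Definition inc_digamma p z : R :=
  (inc_gamma p z)^-1 *
  \int[lebesgue_measure]_(y in `]0, z[) (y `^ (p - 1) * expR (- y) * ln y).

End special_functions.

Section subordinators.
Context {d : measure_display} {T : measurableType d} {R : realType}.
Variable P : probability T R.

(* Time is the half-line [0, +oo[: the values of H at negative times are
   never constrained nor used.  The existence of left limits follows from
   the monotonicity of the paths. *)
Record subordinator (H : R -> {RV P >-> R}) : Prop := Subordinator {
  subordinator_start : forall w, H 0 w = 0 ;
  subordinator_nondecreasing : forall w (s t : R), 0 <= s -> s <= t -> H s w <= H t w ;
  subordinator_right_continuous : forall w (t : R), 0 <= t ->
    H s w @[s --> t^'+] --> H t w ;
  subordinator_stationary : forall (s t : R) (A : set R), 0 <= s -> 0 <= t ->
    measurable A ->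
    P [set w | A (H (s + t) w - H s w)] = P [set w | A (H t w)] ;
  subordinator_independent :
    forall (n : nat) (u : nat -> R) (A : nat -> set R),
    0 <= u 0%N -> (forall i, u i <= u i.+1) -> (forall i, measurable (A i)) ->
    P (\bigcap_(i < n) [set w | A i (H (u i.+1) w - H (u i) w)]) =
    (\prod_(i < n) P [set w | A i (H (u i.+1) w - H (u i) w)%R])%E }.

Definition laplace_exponent (H : R -> {RV P >-> R}) (Phi : R -> R) : Prop :=
  forall t lambda : R, 0 <= t -> 0 <= lambda ->
  ('E_P[fun w => expR (- (lambda * H t w))] = (expR (- (t * Phi lambda)))%:E)%E.

Definition gamma_subordinator (a b : R) (H : R -> {RV P >-> R}) : Prop :=
  subordinator H /\ laplace_exponent H (fun lambda => a * ln (1 + lambda / b)).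

(* The value is +oo on a path that stays in ]0, t[ at all positive times. *)
Definition inverse (H : R -> {RV P >-> R}) (t : R) (w : T) : \bar R :=
  ereal_inf [set s%:E | s in [set s | 0 < s /\ ~ (0 < H s w < t)]].

Definition inverse_survival (H : R -> {RV P >-> R}) (t x : R) : R :=
  fine (P [set w | (x%:E < inverse H t w)%E]).

Definition inverse_density (H : R -> {RV P >-> R}) (t x : R) : R :=
  - derive1 (inverse_survival H t) x.

(* X is almost surely in ]0, +oo[, where its law has density f; take A to be
   the whole of \bar R for the first part. *)
Definition has_positive_density (X : T -> \bar R) (f : R -> R) : Prop :=
  [/\ measurable_fun [set: T] X,
      measurable_fun (`]0, +oo[ : set R) f,
      forall x, 0 < x -> 0 <= f x &
      forall A : set (\bar R), measurable A ->
        P (X @^-1` A) =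
        (\int[lebesgue_measure]_(x in `]0%R, +oo[ `&` EFin @^-1` A) (f x)%:E)%E ].

End subordinators.

(* Main.v *)
(* The paths being nondecreasing and right-continuous, {x < L_t} is the event
   {H_x < t} up to the null set of paths that vanish on a right neighbourhood of
   0, so that the survival function of L_t is x |-> P (H_x < t). A law on
   [0, +oo[ is determined by its Laplace transform, hence H_x has the gamma law
   with shape a x and rate b, and P (H_x < t) = gamma (a x, b t) / Gamma (a x).
   Differentiating in x under the integral signs brings down a factor ln y, and
   the quotient rule gives the formula. The derivative is continuous, so the
   fundamental theorem of calculus identifies it with the density of L_t. *)
From HB Require Import structures.
From mathcomp Require Import ring lra.
Require Import Defs.
Import Order.TTheory GRing.Theory Num.Theory.
Import numFieldNormedType.Exports.
Set Implicit Arguments.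
Unset Strict Implicit.
Unset Printing Implicit Defensive.
Local Open Scope classical_set_scope.
Local Open Scope ring_scope.

(** * Integrals of [y ^ (p - 1) * ln y ^ k * exp (- y)] *)

(** All four special functions are values of one family, the integrals of
    [y ^ (p - 1) * ln y ^ k * exp (- y)] over a set [D], with [k] equal to 0 or 1. Differentiation
    in [p] raises [k] by one, so a single domination argument gives the derivative of the survival
    function and also, through [k = 2], the continuity of that derivative. Uniqueness for Laplace
    transforms is made explicit: polynomials in [exp (- s X)] converge pointwise and boundedly to
    the indicator of a half-line, which recovers tail probabilities directly. The Laplace exponent
    serves once more through an exponential Markov inequality. At level 0 it shows that paths
    vanishing near 0 form a null set, because the exponent is unbounded. At a fixed level and large
    time it shows that the survival function tends to 0, which the fundamental theorem on a
    half-line requires. *)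

Lemma integrable_powR_itv01 (R : realType) (q : R) : 0 < q ->
  (@lebesgue_measure R).-integrable `]0, 1] (fun y => (y `^ (q - 1))%:E).
Proof.
move=> q0; apply/integrableP; split.
  by apply/measurable_EFinP; apply: measurable_funTS; exact: measurable_powR.
under eq_integral do rewrite /= ger0_norm ?powR_ge0//.
(* The antiderivative [y ^ q / q] is used only away from 0, and monotone convergence does the rest.
   Starting at [n.+2] keeps the left endpoint strictly below 1, so that no interval is
   degenerate. *)
have itvE : `]0, 1]%classic = \bigcup_n `[n.+2%:R^-1, 1]%classic :> set R.
  apply/seteqP; split => [x /=|x [n _ /=]]; rewrite !in_itv/=.
    move=> /andP[x0 x1]; exists (Num.bound x^-1) => //=; rewrite in_itv/= x1 andbT.
    rewrite -[leRHS]invrK lef_pV2 ?posrE ?invr_gt0//.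
    rewrite (le_trans (ltW (archi_boundP _)))// ?invr_ge0 ?ltW//.
    by rewrite ltr_nat ltnS leqnSn.
  by move=> /andP[nx ->]; rewrite andbT (lt_le_trans _ nx)// invr_gt0.
rewrite itvE.
have mf A : measurable_fun (A : set R) (fun y : R => (y `^ (q - 1))%:E).
  by apply/measurable_EFinP; apply: measurable_funTS; exact: measurable_powR.
have ndI : nondecreasing_seq
    (fun n => `[n.+2%:R^-1, 1]%classic : set (measurableTypeR R)).
  apply/nondecreasing_seqP => n; rewrite subsetEset.
  by apply: subset_itvr; rewrite bnd_simp lef_pV2 ?posrE// ler_nat.
have cvgI := @ge0_nondecreasing_set_cvg_integral _ _ R
  (fun n => `[n.+2%:R^-1, 1]%classic : set (measurableTypeR R))
  (fun y => (y `^ (q - 1))%:E) lebesgue_measure ndI _ (fun=> mf _) _.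
have {}cvgI := cvgI (fun=> measurable_itv _)
  (fun _ _ _ => powR_ge0 _ _ : (0 <= (_ `^ _)%:E)%E).
apply: (@le_lt_trans _ _ (q^-1)%:E); last by rewrite ltry.
rewrite -(cvg_lim _ cvgI)//.
apply: lime_le; first by apply/cvg_ex; eexists; exact: cvgI.
apply: nearW => n.
have n1 : (n.+2%:R^-1 : R) < 1 by rewrite invf_lt1// ltr1n.
have n0 : 0 < (n.+2%:R^-1 : R) by rewrite invr_gt0.
have dpow r (x : R) : 0 < x -> is_derive x 1 (fun y : R => y `^ r) (r * x `^ (r - 1)).
  move=> x0; apply: DeriveDef; first by apply: derivable_powR; rewrite in_itv/= x0.
  by rewrite -derive1E powR_derive1// in_itv/= x0.
have dF (x : R) : 0 < x -> is_derive x 1 (fun y : R => q^-1 * y `^ q) (x `^ (q - 1)).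
  move=> x0; have := dpow q _ x0 => ?.
  by apply: is_derive_eq; rewrite /GRing.scale/= mulrA mulVf ?mul1r ?gt_eqF.
have cont r (x : R) : 0 < x -> {for x, continuous (fun y : R => y `^ r)}.
  move=> x0; apply: differentiable_continuous; apply/derivable1_diffP.
  by have [] := dpow r _ x0.
rewrite (@continuous_FTC2 _ _ (fun y : R => q^-1 * y `^ q))//.
- rewrite -EFinB lee_fin powR1 mulr1 lerBlDr lerDl.
  by rewrite mulr_ge0 ?powR_ge0// invr_ge0 ltW.
- apply: continuous_in_subspaceT => x /set_mem/=; rewrite in_itv/= => /andP[nx _].
  by apply: cont; apply: lt_le_trans nx.
- split.
  + by move=> x; rewrite in_itv/= => /andP[nx _]; have [] := dF _ (lt_trans n0 nx).
  + by apply: cvg_at_right_filter; apply: cvgM; [exact: cvg_cst|exact: cont].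
  + by apply: cvg_at_left_filter; apply: cvgM; [exact: cvg_cst|exact: cont].
- move=> x; rewrite in_itv/= => /andP[nx _].
  by rewrite derive1E; apply: derive_val; exact: dF (lt_trans n0 nx).
Qed.

Lemma powR_le_add (R : realType) (y p q r : R) : 0 < y -> p <= q <= r ->
  y `^ q <= y `^ p + y `^ r.
Proof.
move=> y0 /andP[pq qr]; have [y1|y1] := leP y 1.
  by rewrite ler_wpDr ?powR_ge0// ger_powR// y0.
by rewrite ler_wpDl ?powR_ge0// ler_powR// ltW.
Qed.

(** Apply [x ^ k <= k! * exp x] to [x = e * |ln y|]: then [exp x] is [y ^ e] or [y ^ (- e)],
    according to the sign of [ln y]. *)
Lemma norm_ln_exprn_le (R : realType) (k : nat) (e y : R) : 0 < e -> 0 < y ->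
  `|ln y| ^+ k <= k`!%:R / e ^+ k * (y `^ e + y `^ (- e)).
Proof.
move=> e0 y0.
rewrite mulrAC ler_pdivlMr ?exprn_gt0// mulrC -exprMn.
have -> : y `^ e + y `^ (- e) = expR (e * ln y) + expR (- e * ln y).
  by rewrite /powR gt_eqF.
have exp_ge (x : R) : 0 <= x -> x ^+ k <= k`!%:R * expR x.
  move=> x0; case: k => [|n].
    by rewrite fact0 mul1r expr0 -[leLHS]expR0 ler_expR.
  rewrite -ler_pdivrMl ?ltr0n ?fact_gt0// mulrC.
  by apply: le_trans (expR_ge1Dxn n x0); rewrite lerDr ler01.
apply: (le_trans (exp_ge _ _)); first by rewrite mulr_ge0// ltW.
rewrite ler_pM2l ?ltr0n ?fact_gt0//.
have [l0|l0] := leP 0 (ln y); first by rewrite ger0_norm// lerDl expR_ge0.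
by rewrite ltr0_norm// mulrN -mulNr lerDr expR_ge0.
Qed.

(** For [y > 0] this is the [k]-th derivative in [p] of the integrand of the gamma function. *)
Definition log_gamma_integrand (R : realType) (k : nat) (p y : R) : R :=
  y `^ (p - 1) * ln y ^+ k * expR (- y).

Definition log_gamma_integral (R : realType) (k : nat) (D : set R) (p : R) : R :=
  \int[lebesgue_measure]_(y in D) log_gamma_integrand k p y.

Lemma measurable_log_gamma_integrand (R : realType) k (p : R) (D : set R) :
  measurable_fun D (log_gamma_integrand k p).
Proof.
apply: measurable_funTS; apply: measurable_funM.
  apply: measurable_funM; first exact: measurable_powR.
  by apply: measurable_funX; exact: measurable_ln.
by apply: measurableT_comp => //; exact: measurable_expR.
Qed.

Lemma integrable_powR_expRN (R : realType) (p : R) : 0 < p ->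
  (@lebesgue_measure R).-integrable `]0, +oo[
    (fun y => (y `^ (p - 1) * expR (- y))%:E).
Proof.
move=> p0.
have mf A : measurable_fun A (fun y : R => (y `^ (p - 1) * expR (- y))%:E).
  apply/measurable_EFinP; rewrite (_ : (fun y => _) = log_gamma_integrand 0 p).
    exact: measurable_log_gamma_integrand.
  by apply/funext => y; rewrite /log_gamma_integrand expr0 mulr1.
have -> : `]0, +oo[%classic = `]0, 1] `|` `]1, +oo[ :> set R.
  by rewrite -itv_bndbnd_setU// bnd_simp.
pose n := Num.bound p.
have pn : p < n%:R by rewrite archi_boundP ?ltW.
(* From [(y / 2) ^ n <= n! * exp (y / 2)] one gets [y ^ n <= C * exp (y / 2)]. The integrand on []1,
   +oo[] is thus below [C * exp (- y / 2)], which is [2 * C] times the exponential density of rate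
   1/2. *)
pose C : R := n`!%:R * 2 ^+ n.
have iexp : (@lebesgue_measure R).-integrable `]1, +oo[
    (fun y => (C * 2)%:E * (exponential_pdf 2^-1 y)%:E)%E.
  apply: integrableZl => //; apply: (integrableS measurableT) => //.
  by apply: integrable_exponential_pdf; rewrite invr_gt0.
have i1 : (@lebesgue_measure R).-integrable `]0, 1]
    (fun y => (y `^ (p - 1) * expR (- y))%:E).
  apply: (le_integrable _ _ _ (integrable_powR_itv01 p0)) => //; first exact: mf.
  move=> y /=; rewrite in_itv/= => /andP[y0 _].
  rewrite lee_fin normrM ler_piMr// ger0_norm ?expR_ge0//.
  by rewrite -expR0 ler_expR oppr_le0 ltW.
have i2 : (@lebesgue_measure R).-integrable `]1, +oo[
    (fun y => (y `^ (p - 1) * expR (- y))%:E).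
  apply: (le_integrable _ _ _ iexp) => //; first exact: mf.
  move=> y /=.
  rewrite in_itv/= andbT => y1; have y0 : 0 < y by rewrite (lt_trans _ y1).
  have -> : exponential_pdf 2^-1 y = 2^-1 * expR (- 2^-1 * y).
    by rewrite exponential_pdfE// ltW.
  rewrite lee_fin.
  rewrite !ger0_norm; last 2 first.
  - by rewrite !mulr_ge0 ?expR_ge0 ?exprn_ge0 ?invr_ge0.
  - by rewrite mulr_ge0 ?powR_ge0 ?expR_ge0.
  rewrite !mulrA mulfK ?gt_eqF//.
  rewrite -ler_pdivlMr ?expR_gt0// -mulrA -expRN opprK -expRD.
  have -> : - 2^-1 * y + y = 2^-1 * y by lra.
  apply: (@le_trans _ _ (y `^ n%:R)).
    by rewrite ler_powR ?ltW//; rewrite ltrBlDr (lt_trans pn)// ltrDl.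
  rewrite (powR_mulrn _ (ltW y0)) /C mulrAC -ler_pdivrMr ?exprn_gt0//.
  rewrite -expr_div_n [leRHS]mulrC [2^-1 * y]mulrC.
  have -> : n = n.-1.+1 by rewrite prednK// -(ltr0n R) (lt_trans p0).
  rewrite -ler_pdivrMr ?ltr0n ?fact_gt0//.
  have y20 : 0 <= y / 2 by rewrite divr_ge0// ltW.
  by apply: le_trans (expR_ge1Dxn n.-1 y20); rewrite lerDr ler01.
apply/integrableP; split; first exact: mf.
rewrite ge0_integral_setU//.
- by apply: lte_add_pinfty; [case/integrableP: i1|case/integrableP: i2].
- by apply: measurableT_comp => //; exact: mf.
- apply/disj_setPS => x [] /=; rewrite !in_itv/= => /andP[_ x1] /andP[].
  by rewrite ltNge x1.
Qed.

Section log_gamma_integral.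
Context {R : realType}.
Local Notation mu := (@lebesgue_measure R).
Variables (k : nat) (D : set (measurableTypeR R)).
Hypotheses (mD : measurable D) (D0 : D `<=` `]0, +oo[).

Let D_gt0 y : D y -> 0 < y.
Proof. by move=> /D0/=; rewrite in_itv/= andbT. Qed.

Lemma integrable_log_gamma_dominant (p : R) : 0 < p -> exists G : R -> R,
  [/\ forall y, 0 <= G y, mu.-integrable D (EFin \o G) &
    forall q y, p / 2 < q < p * 2 -> D y -> `|log_gamma_integrand k q y| <= G y].
Proof.
(* [|ln y| ^ k] is absorbed by [y ^ (- p / 4) + y ^ (p / 4)]. *)
move=> p0; pose e := p / 4; have e0 : 0 < e by rewrite divr_gt0.
pose C := k`!%:R / e ^+ k * 2.
(* For [q] between [p / 2] and [2 * p], both [q - p / 4] and [q + p / 4] lie between [p / 4] and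
   [3 * p], so each of the two powers is at most the sum of the extreme ones. This accounts for the
   factor 2 in [C]. *)
pose G y := C * (y `^ (p / 4 - 1) * expR (- y) + y `^ (p * 3 - 1) * expR (- y)).
have C0 : 0 <= C by rewrite mulr_ge0// divr_ge0// exprn_ge0// ltW.
exists G; split.
- by move=> y; rewrite mulr_ge0// addr_ge0// mulr_ge0 ?powR_ge0 ?expR_ge0.
- rewrite (_ : EFin \o G = (fun y => C%:E *
    ((y `^ (p / 4 - 1) * expR (- y))%:E + (y `^ (p * 3 - 1) * expR (- y))%:E)))%E//.
  apply: (integrableS _ mD D0) => //.
  apply: integrableZl => //; apply: integrableD => //.
    by apply: integrable_powR_expRN; rewrite divr_gt0.
  by apply: integrable_powR_expRN; rewrite mulr_gt0.
- move=> q y /andP[pq qp] /D_gt0 y0.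
  rewrite /log_gamma_integrand !normrM normrX.
  rewrite (ger0_norm (powR_ge0 _ _)) (ger0_norm (expR_ge0 _)) /G -mulrDl mulrA.
  rewrite ler_wpM2r ?expR_ge0//.
  apply: (@le_trans _ _ (y `^ (q - 1) *
      (k`!%:R / e ^+ k * (y `^ e + y `^ (- e))))).
    by rewrite ler_wpM2l ?powR_ge0// norm_ln_exprn_le.
  rewrite mulrCA /C -mulrA ler_wpM2l ?divr_ge0 ?exprn_ge0 ?(ltW e0)//.
  rewrite mulrDr -!powRD; try by rewrite (gt_eqF y0) implybT.
  rewrite mulr_natl mulr2n lerD// powR_le_add//; rewrite /e; apply/andP; split; lra.
Qed.

Lemma integrable_log_gamma_integrand (p : R) : 0 < p ->
  mu.-integrable D (EFin \o log_gamma_integrand k p).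
Proof.
move=> p0; have [G [G0 iG domG]] := integrable_log_gamma_dominant p0.
apply: (le_integrable mD _ _ iG).
  by apply/measurable_EFinP; exact: measurable_log_gamma_integrand.
move=> y Dy; rewrite lee_fin (ger0_norm (G0 _)) domG//.
by apply/andP; split; lra.
Qed.

End log_gamma_integral.

Lemma is_derive_log_gamma_integrand (R : realType) k (p y : R) : 0 < y ->
  is_derive p 1 (fun q => log_gamma_integrand k q y) (log_gamma_integrand k.+1 p y).
Proof.
move=> y0; rewrite /log_gamma_integrand.
have -> : (fun q : R => y `^ (q - 1) * ln y ^+ k * expR (- y)) =
    (fun q => expR ((q - 1) * ln y) * (ln y ^+ k * expR (- y))).
  by apply/funext => q; rewrite /powR gt_eqF// mulrA.
apply: is_derive_eq.
by rewrite /powR gt_eqF// !scaler0 /GRing.scale/= exprS; ring.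
Qed.

Lemma is_derive_log_gamma_integral (R : realType) k (D : set R) (p : R) :
  measurable (D : set (measurableTypeR R)) -> D `<=` `]0, +oo[ -> 0 < p ->
  is_derive p 1 (log_gamma_integral k D) (log_gamma_integral k.+1 D p).
Proof.
move=> mD D0 p0.
have [G [G0 iG domG]] := integrable_log_gamma_dominant k.+1 mD D0 p0.
have Ip : `]p / 2, p * 2[%classic p by rewrite /= in_itv/=; apply/andP; split; lra.
have int q : `]p / 2, p * 2[%classic q ->
    (@lebesgue_measure R).-integrable D (EFin \o log_gamma_integrand k q).
  rewrite /= in_itv/= => /andP[pq _]; apply: integrable_log_gamma_integrand => //.
  by rewrite (lt_trans _ pq)// divr_gt0.
have D_gt0 y : D y -> 0 < y by move=> /D0/=; rewrite in_itv/= andbT.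
have der q y : `]p / 2, p * 2[%classic q -> D y ->
    derivable (log_gamma_integrand k ^~ y) q 1.
  by move=> _ /D_gt0 y0; have [] := is_derive_log_gamma_integrand k q y0.
have d1E q y : D y -> partial1of2 (log_gamma_integrand k) q y =
    log_gamma_integrand k.+1 q y.
  move=> /D_gt0 y0; rewrite partial1of2E.
  by have [] := is_derive_log_gamma_integrand k q y0.
have ub q y : `]p / 2, p * 2[%classic q -> D y ->
    `|partial1of2 (log_gamma_integrand k) q y| <= G y.
  by move=> qI Dy; rewrite d1E// domG//; move: qI; rewrite /= in_itv.
apply: DeriveDef; first exact: (derivable_under_integral mD Ip int der G0 iG ub).
rewrite -derive1E (differentiation_under_integral mD Ip int der G0 iG ub).
by apply: eq_Rintegral => y /set_mem Dy; exact: d1E.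
Qed.

(** A nonnegative integrand with zero integral vanishes almost everywhere; this one is strictly
    positive on [D], which would then be a null set. *)
Lemma log_gamma_integral0_gt0 (R : realType) (D : set R) (p : R) :
  measurable (D : set (measurableTypeR R)) -> D `<=` `]0, +oo[ -> 0 < p ->
  lebesgue_measure D != 0%E ->
  0 < log_gamma_integral 0 D p.
Proof.
move=> mD D0 p0 muD.
have D_gt0 y : D y -> 0 < y by move=> /D0/=; rewrite in_itv/= andbT.
have f_gt0 y : D y -> 0 < log_gamma_integrand 0 p y.
  move=> /D_gt0 y0; rewrite /log_gamma_integrand expr0 mulr1.
  by rewrite mulr_gt0 ?powR_gt0 ?expR_gt0.
rewrite lt_def Rintegral_ge0 ?andbT; last by move=> y /f_gt0/ltW.
apply: contraNN muD => /eqP J0.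
have iJ := integrable_log_gamma_integrand 0 mD D0 p0.
have : (\int[lebesgue_measure]_(y in D) `|(log_gamma_integrand 0 p y)%:E| = 0)%E.
  rewrite -[RHS]/(0%:E) -J0 fineK; last exact: integrable_fin_num.
  by apply: eq_integral => y /set_mem/f_gt0/ltW f0; rewrite gee0_abs.
move/(ae_eq_integral_abs _ mD (measurable_int _ iJ)) => [N [mN N0 DN]].
rewrite -measure_le0 -N0 le_measure ?inE// => y Dy; apply: DN => /= /(_ Dy).
by move=> /eqP; rewrite eqe gt_eqF// f_gt0.
Qed.

(** * Lebesgue measure and integrals under dilations *)

Section scaling.
Context {R : realType} (c : R) (c0 : 0 < c).
Let phi (y : measurableTypeR R) : measurableTypeR R := c * y.
Let mphi : measurable_fun [set: measurableTypeR R] phi.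
Proof. exact: mulrl_measurable. Qed.
Let pushforward_phi : {measure set (measurableTypeR R) -> \bar R} :=
  measure_function_pushforward__canonical__measure_function_Measure
    lebesgue_measure mphi.

(** The right-hand side is a measure in [A] that gives half-open intervals their length, and
    Lebesgue measure is the only such measure. *)
Lemma lebesgue_measure_scale (A : set (measurableTypeR R)) : measurable A ->
  lebesgue_measure A = (c%:E * lebesgue_measure (phi @^-1` A))%E.
Proof.
move=> mA.
pose m := mscale (NngNum (ltW c0)) pushforward_phi.
rewrite -[RHS]/(m A); apply: lebesgue_measure_unique => // _ [[a b]] _ <- /=.
rewrite /m /mscale/= /pushforward/=.
rewrite (_ : _ @^-1` _ = `]c^-1 * a, c^-1 * b]%classic); last first.
  apply/seteqP; split => x /=; rewrite !in_itv/=;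
  by rewrite ltr_pdivrMl// ler_pdivlMl.
rewrite !lebesgue_measure_itv/= !lte_fin ltr_pM2l ?invr_gt0//.
case: ifPn => _; last by rewrite mule0.
by rewrite -!EFinB -EFinM -mulrBr mulrA mulfV ?mul1r// gt_eqF.
Qed.

Lemma ge0_integral_scale (D : set (measurableTypeR R)) (f : R -> \bar R) :
  measurable D -> measurable_fun D (f : measurableTypeR R -> \bar R) ->
  (forall y, D y -> 0 <= f y)%E ->
  (\int[lebesgue_measure]_(y in D) f y =
   c%:E * \int[lebesgue_measure]_(y in phi @^-1` D) f (c * y)%R)%E.
Proof.
move=> mD mf f0.
rewrite -(ge0_integral_pushforward mphi lebesgue_measure mD mf); last first.
  by move=> y /set_mem; exact: f0.
rewrite -(ge0_integral_mscale pushforward_phi mD (NngNum (ltW c0)))//.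
by apply: eq_measure_integral => A mA AD; exact: lebesgue_measure_scale.
Qed.

End scaling.

Lemma integral_powR_expRN_scale (R : realType) (c p : R)
    (D : set (measurableTypeR R)) : 0 < c -> 0 < p -> measurable D ->
  D `<=` `]0, +oo[ ->
  (\int[lebesgue_measure]_(y in ( *%R c) @^-1` D) (y `^ (p - 1) * expR (- (c * y)))%:E =
   (c `^ (- p) * log_gamma_integral 0 D p)%:E)%E.
Proof.
move=> c0 p0 mD D0.
have D_gt0 y : D y -> 0 < y by move=> /D0/=; rewrite in_itv/= andbT.
have iJ := integrable_log_gamma_integrand 0 mD D0 p0.
have mD' : measurable (( *%R c : measurableTypeR R -> measurableTypeR R) @^-1` D).
  by rewrite -[X in measurable X]setTI; exact: mulrl_measurable.
rewrite EFinM fineK; last exact: integrable_fin_num.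
have mL := measurable_log_gamma_integrand 0 p.
rewrite (ge0_integral_scale c0 mD); last 2 first.
- by apply/measurable_EFinP; apply: mL.
- move=> y /D_gt0 y0; rewrite lee_fin /log_gamma_integrand expr0 mulr1.
  by rewrite mulr_ge0 ?powR_ge0 ?expR_ge0.
have -> : (\int[lebesgue_measure]_(y in ( *%R c) @^-1` D)
      (log_gamma_integrand 0 p (c * y)%R)%:E =
    (c `^ (p - 1))%:E * \int[lebesgue_measure]_(y in ( *%R c) @^-1` D)
      (y `^ (p - 1) * expR (- (c * y)))%:E)%E.
  rewrite -ge0_integralZl_EFin//; last 3 first.
  - by move=> y _; rewrite lee_fin mulr_ge0 ?powR_ge0 ?expR_ge0.
  - apply/measurable_EFinP; apply: measurable_funM.
      by apply: measurable_funTS; exact: measurable_powR.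
    apply: measurableT_comp; first exact: measurable_expR.
    by apply: measurableT_comp => //; exact: mulrl_measurable.
  - exact: powR_ge0.
  apply: eq_integral => y /set_mem/D_gt0; rewrite pmulr_rgt0// => y0.
  rewrite -EFinM /log_gamma_integrand expr0 mulr1 powRM ?(ltW c0) ?(ltW y0)//.
  by rewrite mulrA.
rewrite !muleA -!EFinM.
rewrite [X in _ = (X%:E * _)%E](_ : _ = 1) ?mul1e//.
rewrite -{2}(powRr1 (ltW c0)) -!powRD; try by rewrite (gt_eqF c0) implybT.
by rewrite (_ : - p + 1 + (p - 1) = 0) ?powRr0//; ring.
Qed.

(** * Injectivity of the Laplace transform *)

Lemma bernoulli_ineq (R : realDomainType) (x : R) n : 0 <= x <= 1 ->
  1 - n%:R * x <= (1 - x) ^+ n.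
Proof.
move=> /andP[x0 x1]; elim: n => [|n IHn]; first by rewrite mul0r subr0 expr0.
rewrite exprSr; have y0 : 0 <= 1 - x by rewrite subr_ge0.
apply: le_trans (ler_wpM2r y0 IHn).
have : 0 <= n%:R * x * x by rewrite !mulr_ge0.
rewrite -natr1; lra.
Qed.

(** A polynomial approximation of the indicator of [[0, 1/2]], of the kind used in elementary proofs
    of the Stone-Weierstrass theorem: [(1 - x) ^ N] is near 1 or 0 according to whether [N * x] is
    small or large, and here [N * x = (2 * u) ^ (n * n) * u ^ n]. The factor [u ^ n] puts the
    endpoint [u = 1/2] on the side of the limit 1. The square in the exponent lets [2 * u > 1]
    prevail over that factor. *)
Definition threshold_poly (R : realType) (n : nat) (u : R) : R :=
  (1 - u ^+ (n * n + n)) ^+ (2 ^ (n * n)).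

Lemma threshold_poly_itv (R : realType) n (u : R) : 0 <= u <= 1 ->
  0 <= threshold_poly n u <= 1.
Proof.
move=> /andP[u0 u1].
have v0 : 0 <= 1 - u ^+ (n * n + n) by rewrite subr_ge0 exprn_ile1.
by rewrite exprn_ge0// exprn_ile1// lerBlDr lerDl exprn_ge0.
Qed.

(* [2 ^ (n * n) * u ^ (n * n + n)] tends to [0] for [u <= 1/2] and to
   infinity for [u > 1/2]. *)
Lemma cvg_threshold_poly (R : realType) (u : R) : 0 <= u <= 1 ->
  threshold_poly n u @[n --> \oo] --> ((u <= 2^-1)%R%:R : R).
Proof.
move=> /andP[u0 u1].
have half_lt1 : `|2^-1 : R| < 1 by rewrite ger0_norm ?invr_ge0// invf_lt1// ltr1n.
have cvg_half := cvg_expr half_lt1.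
have x01 n : 0 <= u ^+ (n * n + n) <= 1 by rewrite exprn_ge0 //= exprn_ile1.
have [u2|u2] := leP u 2^-1.
  apply: (@squeeze_cvgr _ _ _ _ (fun n => 1 - 2^-1 ^+ n) (fun=> 1)).
  - apply: nearW => n; rewrite andbC.
    have /andP[_ ->]/= := threshold_poly_itv n (introT andP (conj u0 u1)).
    apply: le_trans (bernoulli_ineq _ (x01 n)).
    rewrite lerD2l lerN2 (le_trans (ler_wpM2l _ (_ : _ <= 2^-1 ^+ (n * n + n))))//.
      by rewrite lerXn2r// nnegrE ?invr_ge0.
    by rewrite exprD mulrA natrX -exprMn mulfV// expr1n mul1r.
  - by rewrite -[X in _ --> X]subr0; apply: cvgB => //; exact: cvg_cst.
  - exact: cvg_cst.
have up : 0 < u by rewrite (lt_trans _ u2)// invr_gt0.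
pose q := (2 * u)^-1; have q0 : 0 < q by rewrite invr_gt0 mulr_gt0.
have q1 : `|q| < 1.
  rewrite gtr0_norm// invf_lt1 ?mulr_gt0//; lra.
apply: (@squeeze_cvgr _ _ _ _ (fun=> 0) (fun n => 2^-1 ^+ n)) => //;
  last exact: cvg_cst.
(* Eventually [q ^ n <= u / 2], that is [(2 * u) ^ n * u >= 2]; the [n]-th power of this bounds
   [N * x] below by [2 ^ n]. *)
have /cvgrPdist_le/(_ (u / 2)) := cvg_expr q1.
rewrite divr_gt0// => /(_ isT); apply: filterS => n; rewrite sub0r normrN => qn.
have /andP[-> _]/= := threshold_poly_itv n (introT andP (conj u0 u1)).
set x := u ^+ (n * n + n).
have N0 : 0 < (2 ^ (n * n))%:R * x by rewrite mulr_gt0 ?exprn_gt0// ltr0n expn_gt0.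
(* With [N = 2 ^ (n * n)], this is [(1 - x) ^ N <= exp (- N * x) <= 1 / (N * x)]. *)
apply: (@le_trans _ _ ((2 ^ (n * n))%:R * x)^-1).
  apply: (@le_trans _ _ (expR (- ((2 ^ (n * n))%:R * x)))).
    rewrite -mulrN expRM_natl lerXn2r ?nnegrE ?expR_ge0 ?subr_ge0//.
      by have /andP[] := x01 n.
    exact: expR_ge1Dx.
  rewrite expRN lef_pV2 ?posrE ?expR_gt0// (le_trans _ (expR_ge1Dx _))//.
  by rewrite lerDr.
rewrite natrX /x exprD mulrA -exprMn exprM -exprMn -exprVn lerXn2r ?nnegrE//.
  by rewrite invr_ge0 mulr_ge0 ?exprn_ge0 ?mulr_ge0.
rewrite invfM -exprVn -/q ler_pdivrMr// mulrC; apply: le_trans qn.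
by rewrite ger0_norm// exprn_ge0 ?ltW.
Qed.

Section laplace_inversion.
Context {d : measure_display} {T : measurableType d} {R : realType}.
Variables (mu : {measure set T -> \bar R}) (D : set T) (X w : T -> R).
Hypotheses (mD : measurable D) (mX : measurable_fun D X).
Hypotheses (X0 : forall t, D t -> 0 <= X t).
Hypothesis iw : mu.-integrable D (EFin \o w).

Let expX s t := expR (- (s * X t)).

Let mw : measurable_fun D w.
Proof. exact/measurable_EFinP/(measurable_int _ iw). Qed.

Let mexpX s : measurable_fun D (expX s).
Proof.
apply: (measurableT_comp (@measurable_expR R)); apply: measurableT_comp => //.
exact: measurable_funM.
Qed.

Let expX_itv s t : 0 <= s -> D t -> 0 <= expX s t <= 1.
Proof.
by move=> s0 Dt; rewrite expR_ge0/= expR_le1 oppr_le0 mulr_ge0 ?X0.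
Qed.

Let iexpXw s : 0 <= s -> mu.-integrable D (fun t => (expX s t * w t)%:E).
Proof.
move=> s0; apply: le_integrable iw => //.
  by apply/measurable_EFinP; exact: measurable_funM.
move=> t Dt /=; rewrite lee_fin normrM ler_piMl//.
by have /andP[e0 e1] := expX_itv s0 Dt; rewrite ger0_norm.
Qed.

(** Powers of [exp (- s X)] are again exponentials of multiples of [X], so the binomial expansion
    yields Laplace transforms only. The weight [w] lets the same argument treat a random variable
    ([w = 1] under [P]) and a density against Lebesgue measure. *)
Lemma integral_threshold_poly s n : 0 <= s ->
  (\int[mu]_(t in D) (threshold_poly n (expR (- (s * X t))) * w t)%:E =
   \sum_(i < (2 ^ (n * n)).+1) ((-1) ^+ i *+ 'C(2 ^ (n * n), i))%:E *
     \int[mu]_(t in D) (expR (- ((s * ((n * n + n) * i)%:R) * X t)) * w t)%:E)%E.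
Proof.
move=> s0; set N := (2 ^ (n * n))%N; set k := (n * n + n)%N.
have sk i : 0 <= s * (k * i)%:R by rewrite mulr_ge0.
under [RHS]eq_bigr do rewrite -integralZl ?iexpXw//.
rewrite -integral_sum//; last by move=> i; apply: integrableZl => //; exact: iexpXw.
apply: eq_integral => t _.
under eq_bigr do rewrite -EFinM.
rewrite sumEFin; congr EFin; rewrite /threshold_poly -/N -/k exprBn mulr_suml.
apply: eq_bigr => i _; rewrite expr1n mulr1 -mulrnAl mulrA; congr (_ * _ * _).
rewrite -exprM -expRM_natl; congr expR; ring.
Qed.

(** With this parameter the exponential is at most 1/2 exactly when [c <= X]. The polynomial takes
    values in [[0, 1]], so [|w|] dominates. *)
Lemma cvg_integral_threshold_poly c : 0 < c ->
  (\int[mu]_(t in D) (threshold_poly n (expR (- (ln 2 / c * X t))) * w t)%:E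
    @[n --> \oo] -->
   \int[mu]_(t in D) ((c <= X t)%R%:R * w t)%:E)%E.
Proof.
move=> c0; have ln20 : 0 < ln (2 : R) by rewrite ln_gt0// ltr1n.
have s0 : 0 <= ln 2 / c by rewrite divr_ge0 ?ltW.
apply: (@dominated_cvg _ _ _ mu _ mD _ _ (fun t => `|w t|%:E)) => //.
- move=> n; apply/measurable_EFinP/measurable_funM => //.
  apply: measurable_funX; apply: measurable_funB => //.
  by apply: measurable_funX; exact: mexpX.
- move=> t Dt; apply: cvg_EFin; first exact: nearW.
  apply: cvgM; last exact: cvg_cst.
  have := cvg_threshold_poly (expX_itv s0 Dt).
  rewrite (_ : (_ <= 2^-1) = (c <= X t)) // /expX.
  rewrite -[in LHS](@lnK _ 2^-1) ?posrE ?invr_gt0// ler_expR lnV ?posrE//.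
  by rewrite lerN2 mulrAC ler_pdivlMr// ler_pM2l.
- exact: integrable_norm.
- move=> n t Dt; rewrite lee_fin normrM ler_piMl//.
  have /andP[e0 e1] := threshold_poly_itv n (expX_itv s0 Dt).
  by rewrite ger0_norm.
Qed.

End laplace_inversion.

(* The mean of a threshold polynomial of [expR (- (s * X))] only involves values
   of the Laplace transform of [X], and it converges to the indicator function of
   [c <= X] for [s = ln 2 / c]. *)
Lemma laplace_transform_inj (R : realType) d1 d2 (T1 : measurableType d1)
    (T2 : measurableType d2) (mu1 : {measure set T1 -> \bar R})
    (mu2 : {measure set T2 -> \bar R}) (D1 : set T1) (D2 : set T2)
    (X1 w1 : T1 -> R) (X2 w2 : T2 -> R) (c : R) :
  measurable D1 -> measurable D2 ->
  measurable_fun D1 X1 -> measurable_fun D2 X2 ->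
  (forall t, D1 t -> 0 <= X1 t) -> (forall t, D2 t -> 0 <= X2 t) ->
  mu1.-integrable D1 (EFin \o w1) -> mu2.-integrable D2 (EFin \o w2) ->
  (forall s : R, (0 <= s)%R ->
    \int[mu1]_(t in D1) (expR (- (s * X1 t)) * w1 t)%:E =
    \int[mu2]_(t in D2) (expR (- (s * X2 t)) * w2 t)%:E)%E ->
  0 < c ->
  (\int[mu1]_(t in D1) ((c <= X1 t)%R%:R * w1 t)%:E =
   \int[mu2]_(t in D2) ((c <= X2 t)%R%:R * w2 t)%:E)%E.
Proof.
move=> mD1 mD2 mX1 mX2 X10 X20 iw1 iw2 eqL c0.
have s0 : 0 <= ln 2 / c by rewrite divr_ge0 ?ln_ge0 ?ler1n ?ltW.
have cvg1 := cvg_integral_threshold_poly mD1 mX1 X10 iw1 c0.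
have cvg2 := cvg_integral_threshold_poly mD2 mX2 X20 iw2 c0.
apply: (cvg_unique _ cvg1) => //; apply: cvg_trans cvg2.
apply: near_eq_cvg; apply: nearW => n.
rewrite (integral_threshold_poly mD1 mX1 X10 iw1)//.
rewrite (integral_threshold_poly mD2 mX2 X20 iw2)//.
by apply: eq_bigr => i _; rewrite eqL// mulr_ge0.
Qed.

(** * The law of a gamma subordinator *)

Section special_functions_log_gamma_integral.
Context {R : realType}.
Implicit Types p z : R.

Lemma Gamma_log_gamma_integral p : Gamma p = log_gamma_integral 0 `]0, +oo[ p.
Proof.
by apply: eq_Rintegral => y _; rewrite /log_gamma_integrand expr0 mulr1.
Qed.

Lemma inc_gamma_log_gamma_integral p z :
  inc_gamma p z = log_gamma_integral 0 `]0, z[ p.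
Proof.
by apply: eq_Rintegral => y _; rewrite /log_gamma_integrand expr0 mulr1 mulrC.
Qed.

Lemma digamma_log_gamma_integral p :
  digamma p = (Gamma p)^-1 * log_gamma_integral 1 `]0, +oo[ p.
Proof.
by congr (_ * _); apply: eq_Rintegral => y _; rewrite /log_gamma_integrand expr1.
Qed.

Lemma inc_digamma_log_gamma_integral p z :
  inc_digamma p z = (inc_gamma p z)^-1 * log_gamma_integral 1 `]0, z[ p.
Proof.
congr (_ * _); apply: eq_Rintegral => y _.
by rewrite /log_gamma_integrand expr1 mulrAC.
Qed.

Lemma Gamma_gt0 p : 0 < p -> 0 < Gamma p.
Proof.
move=> p0; rewrite Gamma_log_gamma_integral log_gamma_integral0_gt0//.
by rewrite lebesgue_measure_itv/= ltry.
Qed.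

Lemma inc_gamma_gt0 p z : 0 < p -> 0 < z -> 0 < inc_gamma p z.
Proof.
move=> p0 z0; rewrite inc_gamma_log_gamma_integral log_gamma_integral0_gt0//.
  exact: subset_itvl.
by rewrite lebesgue_measure_itv/= lte_fin z0 oppr0 adde0 eqe gt_eqF.
Qed.

End special_functions_log_gamma_integral.

Section gamma_density.
Context {R : realType} (b p : R) (b0 : 0 < b) (p0 : 0 < p).
Local Notation mu := (@lebesgue_measure R).

Definition gamma_density (y : R) : R :=
  b `^ p / Gamma p * (y `^ (p - 1) * expR (- (b * y))).

Lemma gamma_density_ge0 y : 0 <= gamma_density y.
Proof.
by rewrite mulr_ge0 ?divr_ge0 ?mulr_ge0 ?powR_ge0 ?expR_ge0// ltW// Gamma_gt0.
Qed.

Lemma measurable_gamma_density (D : set (measurableTypeR R)) :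
  measurable_fun D (gamma_density : measurableTypeR R -> R).
Proof.
apply: measurable_funM => //; apply: measurable_funM.
  by apply: measurable_funTS; exact: measurable_powR.
apply: measurableT_comp; first exact: measurable_expR.
by apply: measurableT_comp => //; exact: mulrl_measurable.
Qed.

(** The factor [exp (- s y)] only changes the rate [b] into [b + s], and a dilation brings the rate
    back to 1 at the cost of [(b / (b + s)) ^ p]. The total mass, the Laplace transform and the
    distribution function of the gamma law are all instances; the set [E] is tied to [D] by an
    equation so that it can be given as an interval in each of them. *)
Lemma integral_gamma_density_scale (D E : set (measurableTypeR R)) (s : R) :
  measurable D -> D `<=` `]0, +oo[ -> 0 <= s ->
  ( *%R (b + s)) @^-1` D = E ->
  (\int[mu]_(y in E) (expR (- (s * y)) * gamma_density y)%:E =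
   (expR (- (p * ln (1 + s / b))) * (log_gamma_integral 0 D p / Gamma p))%:E)%E.
Proof.
move=> mD D0 s0 <-.
have bs0 : 0 < b + s by rewrite ltr_wpDr.
have mE : measurable (( *%R (b + s) : measurableTypeR R -> measurableTypeR R) @^-1` D).
  by rewrite -[X in measurable X]setTI; exact: mulrl_measurable.
rewrite (_ : (\int[mu]_(y in _) _ = \int[mu]_(y in ( *%R (b + s)) @^-1` D)
  ((b `^ p / Gamma p)%:E * (y `^ (p - 1) * expR (- ((b + s) * y)))%:E))%E); last first.
  apply: eq_integral => y _; rewrite -EFinM; congr EFin.
  by rewrite /gamma_density mulrDl opprD expRD; ring.
rewrite ge0_integralZl_EFin//; last 3 first.
- by move=> y _; rewrite lee_fin mulr_ge0 ?powR_ge0 ?expR_ge0.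
- apply/measurable_EFinP; apply: measurable_funM.
    by apply: measurable_funTS; exact: measurable_powR.
  apply: measurableT_comp; first exact: measurable_expR.
  by apply: measurableT_comp => //; exact: mulrl_measurable.
- by rewrite divr_ge0 ?powR_ge0// ltW// Gamma_gt0.
rewrite integral_powR_expRN_scale// -EFinM; congr EFin.
have -> : expR (- (p * ln (1 + s / b))) = (b + s) `^ (- p) * b `^ p.
  rewrite /powR !gt_eqF// -expRD; congr expR.
  have -> : 1 + s / b = (b + s) / b by rewrite mulrDl mulfV ?gt_eqF.
  by rewrite ln_div ?posrE//; ring.
by ring.
Qed.

Lemma integral_gamma_density :
  (\int[mu]_(y in `]0%R, +oo[) (gamma_density y)%:E = 1)%E.
Proof.
have := @integral_gamma_density_scale (`]0, +oo[%classic : set R)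
  (`]0, +oo[%classic : set R) 0.
rewrite mul0r !addr0 ln1 mulr0 oppr0 expR0 mul1r -Gamma_log_gamma_integral.
rewrite divff ?gt_eqF ?Gamma_gt0// => <- //.
  by apply: eq_integral => y _; rewrite mul0r oppr0 expR0 mul1r.
by apply/seteqP; split => y /=; rewrite !in_itv/= !andbT pmulr_rgt0.
Qed.

Lemma laplace_gamma_density s : 0 <= s ->
  (\int[mu]_(y in `]0%R, +oo[) (expR (- (s * y)) * gamma_density y)%:E =
   (expR (- (p * ln (1 + s / b))))%:E)%E.
Proof.
move=> s0; have bs0 : 0 < b + s by rewrite ltr_wpDr.
rewrite (@integral_gamma_density_scale (`]0, +oo[%classic : set R))//.
  by rewrite -Gamma_log_gamma_integral divff ?mulr1// gt_eqF// Gamma_gt0.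
by apply/seteqP; split => y /=; rewrite !in_itv/= !andbT pmulr_rgt0.
Qed.

Lemma integral_gamma_density_itv t : 0 < t ->
  (\int[mu]_(y in `]0%R, t[) (gamma_density y)%:E =
   (inc_gamma p (b * t) / Gamma p)%:E)%E.
Proof.
move=> t0.
have := @integral_gamma_density_scale `]0%R, b * t[ `]0%R, t[ 0.
rewrite mul0r !addr0 ln1 mulr0 oppr0 expR0 mul1r -inc_gamma_log_gamma_integral.
move=> <- //.
- by apply: eq_integral => y _; rewrite mul0r oppr0 expR0 mul1r.
- exact: subset_itvl.
- by apply/seteqP; split => y /=; rewrite !in_itv/= pmulr_rgt0// ltr_pM2l.
Qed.

Lemma integrable_gamma_density : mu.-integrable `]0, +oo[ (EFin \o gamma_density).
Proof.
apply/integrableP; split.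
  by apply/measurable_EFinP; apply: measurable_gamma_density.
under eq_integral do rewrite /= ger0_norm ?gamma_density_ge0//.
by rewrite integral_gamma_density ltry.
Qed.

End gamma_density.

Section measurable_rv.
Context {d : measure_display} {T : measurableType d} {R : realType}.
Variables (P : probability T R) (X : {RV P >-> R}) (t : R).

Lemma measurable_rv_lt : measurable [set w | X w < t].
Proof.
rewrite (_ : [set w | _] = X @^-1` `]-oo, t[); first exact: measurable_funPTI.
by apply/seteqP; split => w /=; rewrite in_itv.
Qed.

Lemma measurable_rv_gt : measurable [set w | t < X w].
Proof.
rewrite (_ : [set w | _] = X @^-1` `]t, +oo[); first exact: measurable_funPTI.
by apply/seteqP; split => w /=; rewrite in_itv/= andbT.
Qed.

Lemma measurable_rv_le : measurable [set w | X w <= t].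
Proof.
rewrite (_ : [set w | _] = X @^-1` `]-oo, t]); first exact: measurable_funPTI.
by apply/seteqP; split => w /=; rewrite in_itv.
Qed.

End measurable_rv.

(** Laplace inversion is applied to [X] with weight 1 under [P] and to the identity with weight [g]
    under Lebesgue measure. It equates the tails from [t] on, and complements are then taken in the
    total mass 1. *)
Lemma probability_lt_gamma d (T : measurableType d) (R : realType)
    (P : probability T R) (X : {RV P >-> R}) (b p : R) (t : R) :
  0 < b -> 0 < p -> (forall w, 0 <= X w) ->
  (forall s : R, (0 <= s)%R ->
    'E_P[fun w => expR (- (s * X w))] = (expR (- (p * ln (1 + s / b))))%:E)%E ->
  0 < t ->
  P [set w | X w < t] = (inc_gamma p (b * t) / Gamma p)%:E.
Proof.
move=> b0 p0 X0 LX t0.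
pose g := gamma_density b p.
have ig : lebesgue_measure.-integrable `]0, +oo[ (EFin \o g).
  exact: integrable_gamma_density.
have mA := measurable_rv_lt X t.
have i1 : P.-integrable [set: T] (EFin \o fun=> 1).
  exact: finite_measure_integrable_cst.
have itvE : `]0, +oo[%classic = `]0, t[ `|` `[t, +oo[ :> set R.
  by rewrite -itv_bndbnd_setU// bnd_simp ltW.
have disj : [disjoint `]0, t[%classic & `[t, +oo[%classic : set R].
  apply/disj_setPS => y [] /=; rewrite !in_itv/= => /andP[_ yt] /andP[].
  by rewrite leNgt yt.
have mg (D : set (measurableTypeR R)) : measurable_fun D (EFin \o g).
  by apply/measurable_EFinP; apply: measurable_gamma_density.
have tail : (\int[lebesgue_measure]_(y in `]0%R, +oo[) ((t <= y)%R%:R * g y)%:E =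
    \int[lebesgue_measure]_(y in `[t, +oo[) (g y)%:E)%E.
  rewrite itvE ge0_integral_setU//.
  - rewrite integral0_eq ?add0e.
      apply: eq_integral => y /set_mem/=; rewrite in_itv/= andbT => ->.
      by rewrite mul1r.
    move=> y /=; rewrite in_itv/= => /andP[_].
    by rewrite ltNge => /negbTE ->; rewrite mul0r.
  - apply/measurable_EFinP; apply: measurable_funM; last exact/measurable_EFinP.
    rewrite (_ : (fun y => _) = \1_(`[t, +oo[%classic : set R)).
      exact: measurable_indic.
    by apply/funext => y; rewrite indicE mem_setE in_itv/= andbT.
  - by move=> y _; rewrite lee_fin mulr_ge0// gamma_density_ge0.
have total : ((inc_gamma p (b * t) / Gamma p)%:E +
    \int[lebesgue_measure]_(y in `[t, +oo[) (g y)%:E = 1)%E.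
  rewrite -(integral_gamma_density b0 p0) -integral_gamma_density_itv// itvE.
  apply/esym/ge0_integral_setU => //.
  by move=> y _; rewrite lee_fin gamma_density_ge0.
have XY : (\int[P]_(w in [set: T]) ((t <= X w)%R%:R * 1)%:E =
    \int[lebesgue_measure]_(y in `]0%R, +oo[) ((t <= y)%R%:R * g y)%:E)%E.
  apply: (@laplace_transform_inj R _ _ T (measurableTypeR R) P lebesgue_measure
    setT (`]0, +oo[%classic : set R) X (fun=> 1) idfun g t) => //.
  - exact: measurable_id.
  - by move=> y /=; rewrite in_itv/= andbT => /ltW.
  - move=> s s0; rewrite laplace_gamma_density// -LX// unlock.
    by apply: eq_integral => w _; rewrite mulr1.
have surv : (1 - P [set w | (X w < t)%R] =
    \int[lebesgue_measure]_(y in `[t, +oo[) (g y)%:E)%E.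
  rewrite -probability_setC// -tail -XY.
  rewrite -(setIT (~` _)) -integral_indic//; last exact: measurableC.
  apply: eq_integral => w _; rewrite mulr1 indicE in_setC leNgt.
  by congr (((~~ _)%R%:R)%:E); apply/idP/idP; rewrite inE.
rewrite -surv in total.
move: total; rewrite -[P _]fineK ?fin_num_measure//.
rewrite -!EFinB -EFinD => -[] h.
by congr EFin; move: h; lra.
Qed.

(** * The inverse of a subordinator *)

Section inverse_subordinator.
Context {d : measure_display} {T : measurableType d} {R : realType}.
Variables (P : probability T R) (H : R -> {RV P >-> R}).
Hypothesis sH : subordinator H.

Lemma subordinator_ge0 s w : 0 <= s -> 0 <= H s w.
Proof.
by move=> s0; rewrite -[leLHS](subordinator_start sH w) (subordinator_nondecreasing sH).
Qed.

Lemma inverse_ge0 t w : (0 <= inverse H t w)%E.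
Proof.
by apply: le_ereal_inf_tmp => _ /= [s [s0 _] <-]; rewrite lee_fin ltW.
Qed.

(** If [H] vanishes at some [1 / (n + 1)], monotonicity makes every earlier positive time an exit
    time and the infimum is 0. By monotonicity again, positivity at these countably many times is
    positivity at all positive times. *)
Lemma lt_inverseE t x : 0 < t -> 0 <= x ->
  [set w | (x%:E < inverse H t w)%E] =
  [set w | H x w < t] `&` [set w | forall n, 0 < H n.+1%:R^-1 w].
Proof.
move=> t0 x0; apply/seteqP; split => [w /= xL|w /= [Hxt Hpos]].
  have notin s : 0 < s -> s <= x -> 0 < H s w < t.
    move=> s0 sx; apply: contrapT => Hs; move: xL; apply/negP; rewrite -leNgt.
    by apply: (@le_trans _ _ s%:E); [apply: ereal_inf_lbound; exists s|rewrite lee_fin].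
  split.
    move: x0; rewrite le_eqVlt => /predU1P[<-|x0].
      by rewrite (subordinator_start sH).
    by have /andP[] := notin _ x0 (lexx _).
  move=> n; rewrite ltNge; apply/negP => Hn.
  have Hle0 s : 0 < s -> s <= n.+1%:R^-1 -> (inverse H t w <= s%:E)%E.
    move=> s0 sn; apply: ereal_inf_lbound; exists s => //=; split => //.
    apply/negP; rewrite negb_and -leNgt; apply/orP; left.
    by apply: le_trans Hn; rewrite (subordinator_nondecreasing sH)// ltW.
  move: xL; apply/negP; rewrite -leNgt.
  apply: (@le_trans _ _ 0%E); last by rewrite lee_fin.
  apply/lee_addgt0Pr => e e0; rewrite add0e.
  have m0 : 0 < Num.min e n.+1%:R^-1 by rewrite lt_min e0 invr_gt0 ltr0n.
  apply: le_trans (Hle0 _ m0 _) _; first by rewrite ge_min lexx orbT.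
  by rewrite lee_fin ge_min lexx.
(* The inequality to prove is strict, so it does not suffice that there is no exit up to time [x]:
   right-continuity keeps [H] below [t] until [x + e], and the infimum is at least [x + e]. *)
have : H s w @[s --> x^'+] --> H x w by exact: (subordinator_right_continuous sH).
move=> /cvgrPdist_lt/(_ (t - H x w)).
rewrite subr_gt0 => /(_ Hxt)[e /= e0 He].
apply: (@lt_le_trans _ _ (x + e)%:E); first by rewrite lte_fin ltrDl.
apply: le_ereal_inf_tmp => _ /= [s [s0 Hs] <-]; rewrite lee_fin leNgt.
apply/negP => sxe; apply: Hs; apply/andP; split.
  apply: (lt_le_trans (Hpos (Num.bound s^-1))).
  apply: (subordinator_nondecreasing sH) => //.
  rewrite invf_ple ?posrE// (le_trans (ltW (archi_boundP _)))// ?invr_ge0 ?ltW//.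
  by rewrite ltr_nat.
have [sx|xs] := leP s x.
  by apply: le_lt_trans Hxt; apply: (subordinator_nondecreasing sH) => //; exact: ltW.
have := He s; rewrite /= ltr0_norm ?subr_lt0// => /(_ _ xs).
rewrite opprB ltrBlDl => /(_ sxe).
rewrite distrC ger0_norm ?ltrD2r// subr_ge0.
by apply: (subordinator_nondecreasing sH) => //; exact: ltW.
Qed.

Lemma measurable_subordinator_pos :
  measurable [set w | forall n, 0 < H n.+1%:R^-1 w].
Proof.
rewrite (_ : [set w | _] = \bigcap_n [set w | 0 < H n.+1%:R^-1 w]).
  by apply: bigcapT_measurable => n; exact: measurable_rv_gt.
by apply/seteqP; split => [w Hw n _|w Hw n]; apply: Hw.
Qed.

Lemma measurable_inverse t : 0 < t -> measurable_fun [set: T] (inverse H t).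
Proof.
move=> t0; apply: (measurability _ (ErealGenOInfty.measurableE R)) => //.
move=> _ [_ [x ->] <-]; rewrite setTI.
rewrite (_ : _ @^-1` _ = [set w | (x%:E < inverse H t w)%E]); last first.
  by apply/seteqP; split => w /=; rewrite in_itv/= andbT.
have [x0|x0] := leP 0 x.
  by rewrite lt_inverseE//; apply: measurableI;
    [exact: measurable_rv_lt|exact: measurable_subordinator_pos].
rewrite (_ : [set w | _] = setT)//; apply/seteqP; split => w //= _.
by rewrite (lt_le_trans _ (inverse_ge0 t w))// lte_fin.
Qed.

Variable Phi : R -> R.
Hypothesis LH : laplace_exponent H Phi.

(** Chernoff bound: the indicator of [H s <= t] is at most [exp (lambda * (t - H s))]. *)
Lemma subordinator_le_bound (s t lambda : R) : 0 <= s -> 0 <= lambda ->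
  (P [set w | (H s w <= t)%R] <= (expR (lambda * t - s * Phi lambda))%:E)%E.
Proof.
move=> s0 l0.
have mH := measurable_rv_le (H s) t.
rewrite expRD EFinM -LH// unlock.
have mexp : measurable_fun [set: T] (fun w => expR (- (lambda * H s w))).
  apply: (measurableT_comp (@measurable_expR R)); apply: measurableT_comp => //.
  exact: measurable_funM.
rewrite -ge0_integralZl_EFin//; last exact/measurable_EFinP.
rewrite -[X in P X]setIT -integral_indic//.
apply: ge0_le_integral => //.
- by apply/measurable_EFinP; exact: measurable_indic.
- by apply/measurable_EFinP; exact: measurable_funM.
move=> w _; rewrite -EFinM lee_fin indicE -expRD.
have [/set_mem/= Hst|_] := boolP (w \in _); last by rewrite expR_ge0.
by rewrite -[leLHS]expR0 ler_expR subr_ge0 ler_wpM2l.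
Qed.

End inverse_subordinator.

(** * Densities from survival functions *)

Section survival_density.
Context {d : measure_display} {T : measurableType d} {R : realType}.
Variables (P : probability T R) (L : T -> \bar R) (S l : R -> R).
Hypotheses (mL : measurable_fun [set: T] L).
Hypothesis S_survival : forall x : R, 0 < x -> P [set w | (x%:E < L w)%E] = (S x)%:E.
Hypothesis L_ge0 : forall w, (0 <= L w)%E.
Hypothesis L_gt0 : P [set w | (0 < L w)%E] = 1%E.
Hypothesis S_cvg0 : S x @[x --> +oo] --> 0.
Hypothesis dS : forall x : R, 0 < x -> is_derive x 1 S (- l x).
Hypothesis cl : forall x : R, 0 < x -> {for x, continuous l}.

Let measurable_lt x : measurable [set w | (x%:E < L w)%E].
Proof.
rewrite (_ : [set w | _] = L @^-1` `]x%:E, +oo[%classic); last first.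
  by apply/seteqP; split => w /=; rewrite in_itv/= andbT.
by rewrite -[X in measurable X]setTI; apply: mL => //; exact: emeasurable_itv.
Qed.

Let S_nincr x y : 0 < x -> x <= y -> S y <= S x.
Proof.
move=> x0 xy; rewrite -lee_fin -!S_survival ?(lt_le_trans x0)//.
rewrite le_measure ?inE// => w /=; apply: le_lt_trans.
by rewrite lee_fin.
Qed.

Lemma survival_density_ge0 (x : R) : 0 < x -> 0 <= l x.
Proof.
move=> x0; apply/ler_addgt0Pr => e e0.
(* [S] is only known to be nonincreasing; subtracting [e * y] makes it strictly decreasing, and its
   derivative [- l - e] is then at most 0 for every [e > 0]. *)
pose g : R -> R := S - (fun y => e * y).
have dg (y : R) : 0 < y -> is_derive y 1 g (- l y - e).
  move=> y0; have := dS y0 => ?; apply: is_derive_eq.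
  by rewrite /GRing.scale/= mulr1 ?mulr0 ?addr0.
have : derive1 g x <= 0.
  apply: (@decr_derive1_le0_itvy _ g false 0); last by rewrite in_itv/= x0.
    by move=> y; rewrite inE/= in_itv/= andbT => y0; have [] := dg _ y0.
  move=> y z; rewrite !in_itv/= !andbT => y0 z0 zy.
  by rewrite /g !fctE ler_ltB ?ltr_pM2l// S_nincr// ltW.
by rewrite derive1E; have [_ ->] := dg _ x0; lra.
Qed.

Lemma measurable_survival_density : measurable_fun (`]0, +oo[ : set R) l.
Proof.
apply: open_continuous_measurable_fun => // x.
by rewrite inE/= in_itv/= andbT; exact: cl.
Qed.

Let integral_tail x : 0 < x ->
  (\int[lebesgue_measure]_(y in `]x, +oo[) (l y)%:E = (S x)%:E)%E.
Proof.
move=> x0; rewrite integral_itv_obnd_cbnd; last first.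
  apply/measurable_EFinP; apply: measurable_funS measurable_survival_density => //.
  by apply: subset_itvr; rewrite bnd_simp ltW.
have dNS (y : R) : 0 < y -> is_derive y 1 (- S) (l y).
  by move=> y0; have := dS y0 => ?; apply: is_derive_eq; rewrite opprK.
rewrite (@ge0_continuous_FTC2y _ _ (- S) _ 0).
- by rewrite sub0e EFinN oppeK.
- by move=> y xy; apply: survival_density_ge0; exact: lt_le_trans xy.
- apply: continuous_in_subspaceT => y /set_mem/=; rewrite in_itv/= andbT => xy.
  by apply: cl; exact: lt_le_trans xy.
- by rewrite -oppr0; exact: cvgN.
- by move=> y xy; have [] := dNS y (lt_trans x0 xy).
- apply: cvg_at_right_filter; apply: differentiable_continuous.
  by apply/derivable1_diffP; have [] := dNS _ x0.
- move=> y; rewrite in_itv/= andbT => xy; rewrite derive1E.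
  by have [_ ->] := dNS y (lt_trans x0 xy).
Qed.

(** The tail formula is available only for [x > 0], so 0 is approached along [1 / (n + 1)]: the
    integrals increase to the total mass and the probabilities to that of [0 < L]. *)
Let integral_total : (\int[lebesgue_measure]_(y in `]0%R, +oo[) (l y)%:E = 1)%E.
Proof.
have inv_lt (x : R) : 0 < x -> exists n, n.+1%:R^-1 < x.
  move=> x0; exists (Num.bound x^-1); rewrite invf_plt ?posrE//.
  by rewrite (lt_trans (archi_boundP _)) ?ltr_nat// invr_ge0 ltW.
have le_inv n m : (n <= m)%N -> (m.+1%:R^-1 : R) <= n.+1%:R^-1.
  by move=> nm; rewrite lef_pV2 ?posrE// ler_nat.
have itvE : `]0, +oo[%classic = \bigcup_n `]n.+1%:R^-1, +oo[%classic :> set R.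
  apply/seteqP; split => [x /=|x [n _ /=]]; rewrite !in_itv/= !andbT.
    by move=> /inv_lt[n nx]; exists n => //=; rewrite in_itv/= nx.
  by apply: le_lt_trans.
have cvgI : (\int[lebesgue_measure]_(y in `]n.+1%:R^-1%R, +oo[) (l y)%:E
    @[n --> \oo] --> \int[lebesgue_measure]_(y in `]0%R, +oo[) (l y)%:E)%E.
  rewrite itvE.
  apply: (@ge0_nondecreasing_set_cvg_integral _ _ R
    (fun n => `]n.+1%:R^-1, +oo[%classic : set (measurableTypeR R))) => //.
  - by move=> n m nm; rewrite subsetEset; apply: subset_itvr; rewrite bnd_simp le_inv.
  - move=> n; apply/measurable_EFinP.
    apply: measurable_funS measurable_survival_density => //.
    by apply: subset_itvr; rewrite bnd_simp.
  - move=> n x /=; rewrite in_itv/= andbT => nx; rewrite lee_fin.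
    by apply: survival_density_ge0; apply: le_lt_trans nx.
have cvgP : (P [set w | ((n.+1%:R^-1)%:E < L w)%E] @[n --> \oo] --> 1)%E.
  rewrite -L_gt0 (_ : [set w | (0 < L w)%E] =
      \bigcup_n [set w | ((n.+1%:R^-1)%:E < L w)%E]); last first.
    apply/seteqP; split => [w /=|w [n _ /=]]; last first.
      by apply: lt_trans; rewrite lte_fin.
    case Lw : (L w) => [x| |] // w0; last by exists 0%N => //=; rewrite Lw ltry.
    by have [n nx] := inv_lt x w0; exists n => //=; rewrite Lw lte_fin.
  apply: nondecreasing_cvg_mu => //; first exact: bigcupT_measurable.
  move=> n m nm; rewrite subsetEset => w /=; apply: le_lt_trans.
  by rewrite lee_fin le_inv.
apply: (cvg_unique _ cvgI) => //; apply: cvg_trans cvgP.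
apply: near_eq_cvg; apply: nearW => n.
by rewrite integral_tail// S_survival.
Qed.

(** Both sides are finite measures in [A] that agree on upper rays, a family stable under
    intersection. The rays contain [+oo] while the right-hand side ignores that point, so the
    equality of total masses also says that [L] is almost surely finite. *)
Lemma survival_density_law (A : set (\bar R)) : measurable A ->
  P (L @^-1` A) =
  (\int[lebesgue_measure]_(x in `]0%R, +oo[ `&` EFin @^-1` A) (l x)%:E)%E.
Proof.
pose nu (B : set (\bar R)) : \bar R :=
  (\int[lebesgue_measure]_(x in `]0%R, +oo[ `&` EFin @^-1` B) (l x)%:E)%E.
have mB (B : set (\bar R)) : measurable B ->
    measurable (`]0, +oo[ `&` EFin @^-1` B : set (measurableTypeR R)).
  move=> mB; apply: measurableI => //.
  by rewrite -[X in measurable X]setTI; exact: EFin_measurable.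
have nu0 : nu set0 = 0%E by rewrite /nu preimage_set0 setI0 integral_set0.
have nu_ge0 B : (0 <= nu B)%E.
  apply: integral_ge0 => x [/=]; rewrite in_itv/= andbT => x0 _.
  by rewrite lee_fin survival_density_ge0.
have nu_sigma : semi_sigma_additive nu.
  move=> F mF tF mUF; rewrite /nu preimage_bigcup setI_bigcupr.
  rewrite ge0_integral_bigcup//.
  - by apply: is_cvg_ereal_nneg_natsum_cond => n _ _; exact: nu_ge0.
  - by move=> n; exact: mB.
  - apply/measurable_EFinP; apply: measurable_funS measurable_survival_density => //.
    by move=> x [n _ []].
  - move=> x [n _ [/=]]; rewrite in_itv/= andbT => x0 _.
    by rewrite lee_fin survival_density_ge0.
  - apply/trivIsetP => i j _ _ ij.
    have /trivIsetP/(_ i j I I ij) Fij := tF.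
    have {}Fij : F i `&` F j = set0 := Fij.
    by rewrite setIACA setIid -preimage_setI Fij preimage_set0 setI0.
pose nuM : {measure set (\bar R) -> \bar R} :=
  HB.pack nu (isMeasure.Build _ _ _ nu nu0 nu_ge0 nu_sigma).
pose PL : {measure set (\bar R) -> \bar R} :=
  measure_function_pushforward__canonical__measure_function_Measure P mL.
(* The rays do not cover [-oo], hence the additional set [setT]. *)
pose G := [set B : set (\bar R) | B = setT \/ exists r : R, B = `]r%:E, +oo[%classic].
move=> mA; rewrite -[LHS]/(PL A) -[RHS]/(nuM A).
apply: (measure_unique G (fun=> setT)) mA => //.
- apply/seteqP; split.
    rewrite [X in X `<=` _](ErealGenOInfty.measurableE R).
    by apply: sub_sigma_algebra2 => B [r ->]; right; exists r.
  apply: smallest_sub; first exact: sigma_algebra_measurable.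
  by move=> B [->//|[r ->]]; exact: emeasurable_itv.
- move=> B C [->|[r ->]] [->|[s ->]]; rewrite ?setIT ?setTI.
  + by left.
  + by right; exists s.
  + by right; exists r.
  + right; exists (Num.max r s); apply/seteqP; split => x /=.
      by rewrite !in_itv/= !andbT => -[rx sx]; rewrite EFin_max gt_max rx sx.
    by rewrite !in_itv/= !andbT EFin_max gt_max => /andP[].
- by left.
- by apply/seteqP; split => // x _; exists 0%N.
- move=> B [->|[r ->]].
    rewrite /PL/= /nuM/= /pushforward /nu preimage_setT probability_setT.
    by rewrite setIT integral_total.
  rewrite /PL/= /nuM/= /pushforward /nu.
  rewrite (_ : L @^-1` _ = [set w | (r%:E < L w)%E]); last first.
    by apply/seteqP; split => w /=; rewrite in_itv/= andbT.
  have [r0|r0] := leP r 0.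
    rewrite (_ : _ `&` _ = `]0, +oo[%classic) ?integral_total; last first.
      apply/seteqP; split => [x [//]|x /=]; rewrite !in_itv/= !andbT lte_fin => x0.
      by rewrite x0 (le_lt_trans r0).
    move: r0; rewrite le_eqVlt => /predU1P[->//|r0].
    rewrite (_ : [set w | _] = setT) ?probability_setT//.
    by apply/seteqP; split => // w _ /=; apply: lt_le_trans (L_ge0 w).
  rewrite S_survival// (_ : _ `&` _ = `]r, +oo[%classic) ?integral_tail//.
  apply/seteqP; split => [x [_]|x]; rewrite /= !in_itv/= !andbT => rx.
    exact: rx.
  by split => //; exact: lt_trans rx.
- by move=> n; rewrite /PL/= /pushforward preimage_setT probability_setT ltry.
Qed.

End survival_density.

(** * The inverse gamma subordinator *)

Section inverse_gamma_subordinator.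
Context {d : measure_display} {T : measurableType d} {R : realType}.
Variables (P : probability T R) (a b : R) (H : R -> {RV P >-> R}).
Hypotheses (a0 : 0 < a) (b0 : 0 < b) (gH : gamma_subordinator a b H).

Let sH : subordinator H. Proof. by case: gH. Qed.
Let LH : laplace_exponent H (fun lambda => a * ln (1 + lambda / b)).
Proof. by case: gH. Qed.

(** At level 0 the Chernoff bound is [exp (- s * Phi lambda)], and [Phi] is unbounded. The choice of
    [M] turns the exponent into [- 1 / e], and [exp (- 1 / e) <= e]. *)
Lemma gamma_subordinator_le0 s : 0 < s -> P [set w | H s w <= 0] = 0%E.
Proof.
move=> s0; apply/eqP; rewrite eq_le measure_ge0 andbT.
apply/lee_addgt0Pr => e e0; rewrite add0e.
(* The parameter [b * (expR M - 1)] is the one at which the Laplace exponent is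
   [a * M]. *)
pose M := (a * s * e)^-1; have M0 : 0 < M by rewrite invr_gt0 !mulr_gt0.
have l0 : 0 <= b * (expR M - 1).
  by rewrite mulr_ge0 ?(ltW b0)// subr_ge0 -[leLHS]expR0 ler_expR ltW.
apply: le_trans (subordinator_le_bound LH 0 (ltW s0) l0) _.
rewrite lee_fin mulr0 add0r mulrAC mulfV ?gt_eqF// mul1r addrC subrK expRK.
have -> : s * (a * M) = e^-1.
  by rewrite /M; field; rewrite !gt_eqF.
rewrite expRN -[leRHS]invrK lef_pV2 ?posrE ?expR_gt0 ?invr_gt0//.
by apply: le_trans (expR_ge1Dx _); rewrite lerDr.
Qed.

Let positive_paths := [set w | forall n, 0 < H n.+1%:R^-1 w].

Let mpos : measurable positive_paths.
Proof. exact: measurable_subordinator_pos. Qed.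

Let nonpositive_paths_null : P (~` positive_paths) = 0%E.
Proof.
apply/negligibleP; first exact: measurableC.
apply: (@negligibleS _ _ _ _ (\bigcup_n [set w | H n.+1%:R^-1 w <= 0])).
  by move=> w /= /existsNP[n /negP]; rewrite -leNgt => Hn; exists n.
apply: negligible_bigcup => n.
by apply/negligibleP; [exact: measurable_rv_le|exact: gamma_subordinator_le0].
Qed.

(** The case [x = 0] is included because, with [H 0 = 0 < t], it shows that the inverse is almost
    surely positive. *)
Lemma probability_lt_inverse t x : 0 < t -> 0 <= x ->
  P [set w | (x%:E < inverse H t w)%E] = P [set w | H x w < t].
Proof.
move=> t0 x0; rewrite lt_inverseE//.
have mlt := measurable_rv_lt (H x) t.
rewrite [RHS](measureDI P mlt mpos) [X in (X + _)%E](_ : _ = 0%E) ?add0e//.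
apply/eqP; rewrite -measure_le0 -nonpositive_paths_null le_measure ?inE//.
  exact: measurableD.
exact: measurableC.
Qed.

Lemma gamma_subordinator_lt x t : 0 < x -> 0 < t ->
  P [set w | H x w < t] = (inc_gamma (a * x) (b * t) / Gamma (a * x))%:E.
Proof.
move=> x0 t0; apply: probability_lt_gamma => //; first exact: mulr_gt0.
  by move=> w; apply: (subordinator_ge0 sH); exact: ltW.
by move=> s s0; rewrite LH ?(ltW x0)//; congr ((expR (- _))%:E); ring.
Qed.

Variables (t : R) (t0 : 0 < t).

Let f (x : R) := a * inc_gamma (a * x) (b * t) / Gamma (a * x) *
  (digamma (a * x) - inc_digamma (a * x) (b * t)).

Lemma inverse_survivalE x : 0 < x ->
  inverse_survival H t x = inc_gamma (a * x) (b * t) / Gamma (a * x).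
Proof.
move=> x0; rewrite /inverse_survival probability_lt_inverse ?(ltW x0)//.
by rewrite gamma_subordinator_lt.
Qed.

Let is_derive_scale k (D : set (measurableTypeR R)) (x : R) : 0 < x -> measurable D ->
  D `<=` `]0, +oo[ ->
  is_derive x 1 (fun y => log_gamma_integral k D (a * y))
    (log_gamma_integral k.+1 D (a * x) * a).
Proof.
move=> x0 mD D0; apply: (is_derive1_comp (g := fun y => a * y)).
  by apply: is_derive_log_gamma_integral => //; exact: mulr_gt0.
by apply: is_derive_eq; rewrite /GRing.scale/= mulr1.
Qed.

Let sub_itv : `]0, b * t[ `<=` (`]0, +oo[ : set R).
Proof. exact: subset_itvl. Qed.

Let Gamma_neq0 (x : R) : 0 < x -> log_gamma_integral 0 `]0, +oo[ (a * x) != 0.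
Proof.
by move=> x0; rewrite -Gamma_log_gamma_integral gt_eqF// Gamma_gt0// mulr_gt0.
Qed.

Let inc_gamma_neq0 (x : R) : 0 < x -> log_gamma_integral 0 `]0, b * t[ (a * x) != 0.
Proof.
by move=> x0; rewrite -inc_gamma_log_gamma_integral gt_eqF// inc_gamma_gt0// mulr_gt0.
Qed.

(** [digamma] and [inc_digamma] are the logarithmic derivatives in [p] of [Gamma] and [inc_gamma],
    so the bracket in [f] is minus the logarithmic derivative of their quotient; the factor [a]
    comes from the argument [a * x]. *)
Lemma is_derive_inverse_survival (x : R) : 0 < x ->
  is_derive x 1 (inverse_survival H t) (- f x).
Proof.
move=> x0.
apply: (@near_eq_is_derive _ _ _ (fun y => log_gamma_integral 0 `]0, b * t[ (a * y) *
   (log_gamma_integral 0 `]0, +oo[ (a * y))^-1)).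
  near=> y; rewrite inverse_survivalE; last by near: y; exact: lt_nbhsr.
  by rewrite Gamma_log_gamma_integral inc_gamma_log_gamma_integral.
have d1 := is_derive_scale 0 x0 (measurable_itv _) sub_itv.
have d2 := is_derive_scale 0 x0 (measurable_itv _) (@subset_refl _ (`]0, +oo[ : set R)).
have d3 := @is_deriveV _ (fun y => log_gamma_integral 0 `]0, +oo[ (a * y)) _ _ _
  (Gamma_neq0 x0) d2.
apply: is_derive_eq.
rewrite /f digamma_log_gamma_integral inc_digamma_log_gamma_integral.
rewrite Gamma_log_gamma_integral inc_gamma_log_gamma_integral /GRing.scale/=.
by field; rewrite Gamma_neq0// inc_gamma_neq0.
Unshelve. all: by end_near. Qed.

Lemma inverse_densityE (x : R) : 0 < x -> inverse_density H t x = f x.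
Proof.
move=> x0; rewrite /inverse_density derive1E.
by have [_ ->] := is_derive_inverse_survival x0; rewrite opprK.
Qed.

(** The closed form involves the integrals with [k = 0] and [k = 1], each continuous because it is
    differentiable. *)
Lemma continuous_inverse_density (x : R) : 0 < x ->
  {for x, continuous (inverse_density H t)}.
Proof.
move=> x0.
have cJ k (D : set (measurableTypeR R)) : measurable D -> D `<=` `]0, +oo[ ->
    {for x, continuous (fun y => log_gamma_integral k D (a * y))}.
  move=> mD D0; apply: differentiable_continuous; apply/derivable1_diffP.
  by have [] := is_derive_scale k x0 mD D0.
have cf : {for x, continuous f}.
  have -> : f = fun y => a * log_gamma_integral 0 `]0, b * t[ (a * y) /
      log_gamma_integral 0 `]0, +oo[ (a * y) *
      ((log_gamma_integral 0 `]0, +oo[ (a * y))^-1 *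
         log_gamma_integral 1 `]0, +oo[ (a * y) -
       (log_gamma_integral 0 `]0, b * t[ (a * y))^-1 *
         log_gamma_integral 1 `]0, b * t[ (a * y)).
    apply/funext => y.
    rewrite /f digamma_log_gamma_integral inc_digamma_log_gamma_integral.
    by rewrite Gamma_log_gamma_integral inc_gamma_log_gamma_integral.
  apply: cvgM.
    apply: cvgM; first by apply: cvgM; [exact: cvg_cst|exact: cJ].
    by apply: cvgV; [exact: Gamma_neq0|exact: cJ].
  apply: cvgB; apply: cvgM; try exact: cJ.
    by apply: cvgV; [exact: Gamma_neq0|exact: cJ].
  by apply: cvgV; [exact: inc_gamma_neq0|exact: cJ].
rewrite /prop_for /continuous_at inverse_densityE//; apply: cvg_trans cf.
apply: near_eq_cvg; near=> y; rewrite inverse_densityE//.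
by near: y; exact: lt_nbhsr.
Unshelve. all: by end_near. Qed.

Lemma inverse_survival_cvg0 : inverse_survival H t x @[x --> +oo] --> 0.
Proof.
(* This is the Laplace exponent at 1: the Chernoff bound with [lambda = 1] decays like
   [exp (- x * k)]. *)
pose k := a * ln (1 + 1 / b).
have k0 : 0 < k by rewrite mulr_gt0// ln_gt0// ltrDl divr_gt0.
apply: (@squeeze_cvgr _ _ _ _ (fun=> 0) (fun x => expR t * expR (- (x * k)))).
- near=> x; have x0 : 0 < x by near: x; exact: nbhs_pinfty_gt.
  rewrite /inverse_survival fine_ge0 ?measure_ge0//=.
  rewrite -lee_fin fineK ?fin_num_measure//; last first.
    by rewrite lt_inverseE ?(ltW x0)//; apply: measurableI => //; exact: measurable_rv_lt.
  rewrite probability_lt_inverse ?(ltW x0)// -expRD.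
  have := subordinator_le_bound LH t (ltW x0) ler01; rewrite mul1r.
  apply: le_trans; apply: le_measure; rewrite ?inE.
  + exact: measurable_rv_lt.
  + exact: measurable_rv_le.
  + by move=> w /= /ltW.
- exact: cvg_cst.
- rewrite -[X in _ --> X](mulr0 (expR t)); apply: cvgM; first exact: cvg_cst.
  apply: (@cvg_comp _ _ _ (fun x => x * k) (fun x => expR (- x)) _ (pinfty_nbhs R));
    last exact: cvgr_expR.
  exact: gt0_cvgMly.
Unshelve. all: by end_near. Qed.

End inverse_gamma_subordinator.

Theorem theorem6 (d : measure_display) (T : measurableType d) (R : realType)
    (P : probability T R) (a b : R) (H : R -> {RV P >-> R})
    (ha : 0 < a) (hb : 0 < b) (hH : gamma_subordinator a b H) :
  forall t : R, 0 < t ->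
    has_positive_density P (inverse H t) (inverse_density H t) /\
    forall x : R, 0 < x ->
      derivable (inverse_survival H t) x 1 /\
      inverse_density H t x =
        a * inc_gamma (a * x) (b * t) / Gamma (a * x) *
        (digamma (a * x) - inc_digamma (a * x) (b * t)).
Proof.
move=> t t0; have [sH _] := hH.
have mL := measurable_inverse sH t0.
have dS (x : R) : 0 < x ->
    is_derive x 1 (inverse_survival H t) (- inverse_density H t x).
  move=> x0; rewrite (inverse_densityE ha hb hH t0 x0).
  exact: is_derive_inverse_survival.
split; last first.
  move=> x x0; split; last exact: inverse_densityE.
  by have [] := dS x x0.
have SE (x : R) : 0 < x ->
    P [set w | (x%:E < inverse H t w)%E] = (inverse_survival H t x)%:E.
  move=> x0; rewrite /inverse_survival fineK// fin_num_measure//.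
  rewrite (lt_inverseE sH t0 (ltW x0)); apply: measurableI.
    exact: measurable_rv_lt.
  exact: measurable_subordinator_pos.
have L0 : P [set w | (0 < inverse H t w)%E] = 1%E.
  rewrite (probability_lt_inverse ha hb hH)//.
  rewrite (_ : [set w | _] = setT) ?probability_setT//.
  by apply/seteqP; split => // w _ /=; rewrite (subordinator_start sH).
have cl (x : R) := @continuous_inverse_density _ _ _ _ _ _ _ ha hb hH _ t0 x.
have Soo := inverse_survival_cvg0 ha hb hH t0.
split => //.
- exact: measurable_survival_density.
- by move=> x x0; exact: (survival_density_ge0 mL SE dS).
- move=> A mA; apply: (survival_density_law mL SE) => //.
  exact: inverse_ge0.
Qed.
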